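(* Let $d\in\mathbb{N}$, $s,\alpha,\beta,\gamma\in\mathbb{R}$, $p,q\in(0,\infty]$, and $\mu,\nu\in[-d,0]$. Assume that $a$ follows a Besov--Bernoulli sequence prior with parameters $(\alpha,\beta,\gamma,\mu,\nu)$ and template random variable $X$ satisfying $\mathbb{P}(X\neq0)>0$. If $a\in b^s_{p,q}(\mathbb{R}^d)$ almost surely, then Property A' is satisfied.
   Context: Notation: $\mathbb{N}=\{1,2,\dots\}$, $\mathbb{N}_0=\mathbb{N}\cup\{0\}$, $d/\infty=0$. $F,M$ are two symbols; $T_0=\{F\}^d$, $T_j=\{F,M\}^d\setminus T_0$ for $j\in\mathbb{N}$, and $J=\{(j,t,m): j\in\mathbb{N}_0, t\in T_j, m\in\mathbb{Z}^d\}$. $\|\cdot\|_{\ell_p}$ is the usual (quasi-)norm (supremum if $p=\infty$), and $\mathbf 1_{j=0}$ is $1$ if $j=0$ and $0$ otherwise. Besov sequence space: $b^s_{p,q}(\mathbb{R}^d)$ is the set of $a=(a_{j,t,m})_{(j,t,m)\in J}\in\mathbb{R}^J$ with $\|a\|_{b^s_{p,q}(\mathbb{R}^d)}:=\big\|\big(2^{j(s+\frac d2-\frac dp)}\|(a_{j,t,m})_{m\in\mathbb{Z}^d}\|_{\ell_p}\big)_{j\in\mathbb{N}_0,t\in T_j}\big\|_{\ell_q}<\infty$. Besov--Bernoulli sequence prior: $a=(a_{j,t,m})_{(j,t,m)\in J}$ follows a Besov--Bernoulli sequence prior with parameters $(\alpha,\beta,\gamma,\mu,\nu)$ and (real-valued)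 template random variable $X$ if, for $(j,t,m)\in\mathbb{N}_0\times\{F,M\}^d\times\mathbb{Z}^d$, there are i.i.d. random variables $\xi_{j,t,m}\sim X$ and Bernoulli$(\varrho_{j,m})$-distributed random variables $\lambda_{j,t,m}$, independent among each other and from all the $\xi_{j,t,m}$, with $\varrho_{j,m}=2^{j\mu}\big(1+\frac{\|m\|_\infty}{2^j}\big)^\nu$, such that $a_{j,t,m}=2^{j\alpha}\big(1+\frac{\|m\|_\infty}{2^j}\big)^{\beta+(\gamma-\beta)\mathbf 1_{j=0}}\lambda_{j,t,m}\xi_{j,t,m}$. Property A' (for $d,s,p,q,\alpha,\beta,\gamma,\mu,\nu$): one of the following holds: (a) $p\neq\infty$, $q\neq\infty$, $\gamma+\frac{d+\nu}{p}<0$, $\beta+\frac{d+\nu}{p}<0$, $s+\frac d2+\alpha+\frac\mu p<0$; (b) $p\neq\infty$, $q=\infty$, $\gamma+\frac{d+\nu}{p}<0$, $\beta+\frac{d+\nu}{p}<0$, $s+\frac d2+\alpha+\frac\mu p\le0$; (c) $p=\infty$, $q\neq\infty$, $\gamma\le0$, $\beta\le0$, $s+\frac d2+\alpha<0$; (d) $p=\infty$, $q=\infty$, $\gamma\le0$, $\beta\le0$, $s+\frac d2+\alpha\le0$. *)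

(* Defs.v *)
From HB Require Import structures.
From mathcomp Require Import all_boot all_order all_algebra.
From mathcomp Require Import all_classical all_reals all_analysis.

Set Implicit Arguments.
Unset Strict Implicit.
Unset Printing Implicit Defensive.

Import Order.TTheory GRing.Theory Num.Theory.
Import numFieldNormedType.Exports.

Local Open Scope classical_set_scope.
Local Open Scope ring_scope.

(** The two symbols F and M *)
Inductive symbol : Type := symF | symM.

Definition bool_of_symbol (x : symbol) : bool :=
  if x is symF then true else false.
Definition symbol_of_bool (b : bool) : symbol := if b then symF else symM.

Lemma bool_of_symbolK : cancel bool_of_symbol symbol_of_bool.
Proof. by case. Qed.

HB.instance Definition _ := Finite.copy symbol (can_type bool_of_symbolK).

Definition symbols (d : nat) : finType := {ffun 'I_d -> symbol}.
Definition Zlattice (d : nat) : choiceType := {ffun 'I_d -> int}.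

Definition Tset (d j : nat) : {set symbols d} :=
  (if j == 0%N then [set [ffun=> symF]] else ~: [set [ffun=> symF]])%SET.

Definition scale_index (d : nat) : choiceType :=
  {jt : nat * symbols d | jt.2 \in Tset d jt.1}.

(** The index set J, with (j, t, m) bracketed as ((j, t), m). *)
Definition J_index (d : nat) : choiceType :=
  (scale_index d * Zlattice d)%type.

(** The larger index set N_0 x {F, M}^d x Z^d of the random variables xi and
    lambda, bracketed in the same way. *)
Definition full_index (d : nat) : choiceType :=
  ((nat * symbols d) * Zlattice d)%type.

Definition J_to_full (d : nat) (i : J_index d) : full_index d :=
  (val i.1, i.2).

Definition sup_normZ (d : nat) (m : Zlattice d) : nat :=
  \max_(i < d) `|m i|%N.

Section sequence_norms.
Context {R : realType}.

Definition divp (x : R) (p : \bar R) : R := if p is r%:E then x / r else 0.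

(** Norm of an extended-real-valued family, since the inner norm of the Besov
    norm may be infinite; only meant for 0 < p <= +oo and I nonempty. *)
Definition lp_norm (I : choiceType) (p : \bar R) (u : I -> \bar R) : \bar R :=
  match p with
  | r%:E => ((\esum_(i in [set: I]) (`|u i| `^ r)) `^ r^-1)%E
  | _ => ereal_sup [set `|u i|%E | i in [set: I]]
  end.

Definition besov_norm (d : nat) (s : R) (p q : \bar R) (a : J_index d -> R)
    : \bar R :=
  lp_norm q (fun jt : scale_index d =>
    ((2 `^ ((val jt).1%:R * (s + d%:R / 2 - divp d%:R p)))%:E *
     lp_norm p (fun m : Zlattice d => (a (jt, m))%:E))%E).

Definition besov_space (d : nat) (s : R) (p q : \bar R)
    : set (J_index d -> R) :=
  [set a | (besov_norm s p q a < +oo)%E].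

(** The quantity 1 + ||m||_oo / 2^j *)
Definition decay (d j : nat) (m : Zlattice d) : R :=
  1 + (sup_normZ m)%:R / 2 ^+ j.

(** For mu, nu <= 0 this lies in ]0, 1]. *)
Definition activation (d : nat) (mu nu : R) (j : nat) (m : Zlattice d) : R :=
  2 `^ (j%:R * mu) * decay j m `^ nu.

Definition amplitude (d : nat) (alpha beta gamma : R) (j : nat)
    (m : Zlattice d) : R :=
  2 `^ (j%:R * alpha) *
  decay j m `^ (beta + (gamma - beta) * (j == 0%N)%:R).

End sequence_norms.

Section prior.
Context {disp : measure_display} {Omega : measurableType disp} {R : realType}.
Variable P : probability Omega R.

(** Mutual independence of a family of classes of events, and below of random
    variables through the events they generate (this allows different
    codomains within one family). *)
Definition mutually_independent (I : choiceType)
    (E : I -> set_system Omega) : Prop :=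
  forall (s : seq I) (A : I -> set Omega), uniq s ->
    (forall i, i \in s -> E i (A i)) ->
    P (\big[setI/setT]_(i <- s) A i) = (\prod_(i <- s) P (A i))%E.

Definition events_of (disp' : measure_display) (T : measurableType disp')
    (Y : {RV P >-> T}) : set_system Omega :=
  preimage_set_system setT Y measurable.

Definition same_distribution (Y Z : {RV P >-> R}) : Prop :=
  forall B : set R, measurable B -> distribution P Y B = distribution P Z B.

Definition is_bernoulli (r : R) (Y : {RV P >-> bool}) : Prop :=
  forall B : set bool, distribution P Y B = bernoulli_prob r B.

Definition besov_bernoulli_prior (d : nat) (alpha beta gamma mu nu : R)
    (X : {RV P >-> R}) (a : J_index d -> {RV P >-> R}) : Prop :=
  exists (xi : full_index d -> {RV P >-> R})
         (lam : full_index d -> {RV P >-> bool}),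
    [/\ forall k, same_distribution (xi k) X,
        forall k, is_bernoulli (activation mu nu k.1.1 k.2) (lam k),
        mutually_independent
          (fun k : full_index d + full_index d =>
             match k with
             | inl k => events_of (xi k)
             | inr k => events_of (lam k)
             end)
      & forall (i : J_index d) (w : Omega),
          let k := J_to_full i in
          a i w = amplitude alpha beta gamma k.1.1 k.2 *
                  (lam k w)%:R * xi k w].

End prior.

Definition property_A' {R : realType} (d : nat) (s : R) (p q : \bar R)
    (alpha beta gamma mu nu : R) : Prop :=
  [\/ [/\ p <> +oo%E, q <> +oo%E,
          gamma + divp (d%:R + nu) p < 0, beta + divp (d%:R + nu) p < 0
        & s + d%:R / 2 + alpha + divp mu p < 0],
      [/\ p <> +oo%E, q = +oo%E,
          gamma + divp (d%:R + nu) p < 0, beta + divp (d%:R + nu) p < 0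
        & s + d%:R / 2 + alpha + divp mu p <= 0],
      [/\ p = +oo%E, q <> +oo%E, gamma <= 0, beta <= 0
        & s + d%:R / 2 + alpha < 0]
    | [/\ p = +oo%E, q = +oo%E, gamma <= 0, beta <= 0
        & s + d%:R / 2 + alpha <= 0]].

(* Main.v *)
Require Import Defs.
From mathcomp Require Import all_boot all_order all_algebra.
From mathcomp Require Import all_classical all_reals all_analysis.
From mathcomp Require Import measurable_realfun.
From mathcomp Require Import ring lra.

Set Implicit Arguments.
Unset Strict Implicit.
Unset Printing Implicit Defensive.

Import Order.TTheory GRing.Theory Num.Theory.

Local Open Scope classical_set_scope.
Local Open Scope ring_scope.

(** Let [c > 0] be such that [|X| >= c] has positive probability.  Call a
    coefficient active when its Bernoulli variable is 1 and its template is at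
    least [c] in modulus; activity is pairwise independent, with probability
    proportional to the Bernoulli parameter, and an active coefficient has
    modulus at least [c] times its amplitude.  It therefore suffices to count
    active coefficients.

    They are counted in the dyadic boxes [2^(l+j) <= m_i < 2^(l+j+1)] at level
    [j].  There the decay factor is comparable to [2^l], so the amplitude and
    the activation probability are comparable to fixed powers of two, and the
    expected number of active coefficients is at least a constant times
    [2^(j(d+mu)+l(d+nu))].  Because [mu, nu >= -d], these expectations stay
    bounded away from 0 along every sequence of boxes.

    By the Paley-Zygmund inequality each box contains at least half of its
    expected number with probability bounded below, and since
    [P (limsup F_n) >= inf P (F_n)], with positive probability this happens in
    infinitely many boxes.  Membership in the Besov space being almost sure,
    some sample point has both properties ([ae_exists_recurrent]).

    At such a sample point infinitely many disjoint blocks of coefficients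
    contribute [2^(n e)] to the norm, up to a constant, which a finite norm
    allows only for [e < 0], or [e <= 0] for a supremum
    ([lp_norm_exponent_bound]).  Going to infinity in [m] at levels 0 and 1
    gives the conditions on gamma and beta through the inner norm; going to
    infinity in [j] with [l = 0] gives the condition on the smoothness through
    the outer norm. *)

(** * Lower bounds for sequence quasi-norms *)

Lemma divpE (R : realType) (x : R) (p : \bar R) : Defs.divp x p = x * Defs.divp 1 p.
Proof. by case: p => [r||]; rewrite /Defs.divp ?mulr0// div1r. Qed.

Lemma lp_norm_ge_sum (R : realType) (I : choiceType) (r : R)
    (u : I -> \bar R) (W : seq I) : 0 < r -> uniq W ->
  ((\sum_(i <- W) `|u i| `^ r) `^ r^-1 <= lp_norm r%:E u)%E.
Proof.
move=> r0 uW.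
apply: gt0_ler_poweR; rewrite ?invr_ge0 ?(ltW r0)//.
- rewrite in_itv/= leey andbT; apply: sume_ge0 => i _; exact: poweR_ge0.
- rewrite in_itv/= leey andbT; apply: esum_ge0 => i _; exact: poweR_ge0.
apply: esum_ge; exists [set` W]; first by split.
by rewrite fsbig_seq.
Qed.

Lemma lp_norm_ge_coord (R : realType) (I : choiceType) (p : \bar R)
    (u : I -> \bar R) (i : I) : (0 < p)%E -> (`|u i| <= lp_norm p u)%E.
Proof.
case: p => [r||]//=; last by move=> _; apply: ereal_sup_ubound; exists i.
rewrite lte_fin => r0; have := @lp_norm_ge_sum R I r u [:: i] r0 isT.
rewrite big_seq1; case: (u i) => [x||]/=; last 2 first.
- by rewrite gt_eqF//= gt_eqF ?invr_gt0//.
- by rewrite gt_eqF//= gt_eqF ?invr_gt0//.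
by rewrite -powRrM mulfV ?gt_eqF// powRr1.
Qed.

Lemma ler_powRl (R : realType) (r x y : R) : 0 <= r -> 0 <= x -> x <= y ->
  x `^ r <= y `^ r.
Proof.
move=> r0 x0 xy; apply: ge0_ler_powR => //; rewrite nnegrE//; exact: le_trans xy.
Qed.

Lemma sum_poweR_ge_count (R : realType) (I : choiceType) (r x : R)
    (u : I -> \bar R) (W : seq I) : 0 < r -> 0 <= x ->
  ((x `^ r * (count (fun i => x%:E <= `|u i|)%E W)%:R)%:E
     <= \sum_(i <- W) `|u i| `^ r)%E.
Proof.
move=> r0 x0; elim: W => [|i W IH]; first by rewrite big_nil/= mulr0.
rewrite big_cons/= natrD mulrDr EFinD leeD//.
case: (boolP (x%:E <= `|u i|)%E) => xu; last by rewrite mulr0 poweR_ge0.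
rewrite mulr1 -poweR_EFin; apply: gt0_ler_poweR => //; rewrite ?in_itv/= ?leey ?andbT//.
exact: ltW.
Qed.

(** Writing the exponent as [divp 1 p] makes the bound uniform in [p]: for
    [p = +oo] it is 0, and a single large entry gives the bound [x]. *)
Lemma lp_norm_ge_count (R : realType) (I : choiceType) (p : \bar R) (x y : R)
    (u : I -> \bar R) (W : seq I) : (0 < p)%E -> 0 <= x -> 0 < y -> uniq W ->
  y <= (count (fun i => x%:E <= `|u i|)%E W)%:R ->
  ((x * y `^ Defs.divp 1 p)%:E <= lp_norm p u)%E.
Proof.
move=> p0 x0 y0 uW hy; case: p p0 => [r||]//; last first.
  move=> _; rewrite /Defs.divp powRr0 mulr1.
  have : has (fun i => (x%:E <= `|u i|)%E) W.
    by rewrite has_count -(ltr_nat R); apply: lt_le_trans hy.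
  move=> /hasP[i _ /le_trans]; apply; apply: (@lp_norm_ge_coord R I +oo%E).
  by rewrite lt0y.
rewrite lte_fin => r0; apply: le_trans (@lp_norm_ge_sum R I r u W r0 uW).
apply: (@le_trans _ _
  ((x `^ r * (count (fun i => x%:E <= `|u i|)%E W)%:R)%:E `^ r^-1)%E); last first.
  apply: gt0_ler_poweR; rewrite ?invr_ge0 ?(ltW r0)// ?in_itv/= ?leey ?andbT.
  - by rewrite lee_fin mulr_ge0 ?powR_ge0.
  - by apply: sume_ge0 => i _; exact: poweR_ge0.
  - exact: sum_poweR_ge_count.
rewrite poweR_EFin lee_fin /Defs.divp div1r powRM ?powR_ge0// -powRrM mulfV ?gt_eqF// powRr1//.
rewrite ler_wpM2l//; apply: ler_powRl; rewrite ?invr_ge0 ?(ltW r0)//; exact: ltW.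
Qed.

(** Infinitely many disjoint blocks, each carrying mass at least [C], contain
    finite families of arbitrarily large mass; disjointness is what makes the
    masses add up. *)
Lemma lp_norm_recurrent_blocks (R : realType) (I : choiceType) (r C : R)
    (u : I -> \bar R) (W : nat -> seq I) :
  0 < r -> 0 < C -> (forall n, uniq (W n)) ->
  (forall m n i, i \in W m -> i \in W n -> m = n) ->
  (forall N, exists2 n, (N <= n)%N & (C%:E <= \sum_(i <- W n) `|u i| `^ r)%E) ->
  lp_norm r%:E u = +oo%E.
Proof.
move=> r0 C0 uW dW io.
(* K disjoint blocks, of index below N, are merged into the sequence s. *)
have H K : exists N (s : seq I), [/\ uniq s,
    forall i, i \in s -> exists2 n, (n < N)%N & i \in W n
    & ((K%:R * C)%:E <= \sum_(i <- s) `|u i| `^ r)%E].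
  elim: K => [|K [N [s [us sW hs]]]].
    by exists 0%N, [::]; split => //; rewrite mul0r big_nil.
  have [n Nn hn] := io N; exists n.+1, (W n ++ s); split.
  - rewrite cat_uniq uW us andbT/=; apply/hasPn => i /sW[m mN iWm].
    by apply/negP => iWn; move: mN; rewrite (dW _ _ _ iWm iWn) ltnNge Nn.
  - move=> i; rewrite mem_cat => /orP[iW|/sW[m mN iW]]; first by exists n.
    by exists m => //; rewrite ltnS (leq_trans (ltnW mN)).
  - rewrite big_cat/= -natr1 mulrDl mul1r addrC EFinD; exact: leeD.
suff : (\esum_(i in [set: I]) `|u i| `^ r)%E = +oo%E :> \bar R.
  by rewrite /lp_norm => ->; rewrite poweRyr// invr_neq0// gt_eqF.
have e0 : (0 <= \esum_(i in [set: I]) `|u i| `^ r)%E.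
  by apply: esum_ge0 => i _; exact: poweR_ge0.
have HK K : ((K%:R * C)%:E <= \esum_(i in [set: I]) `|u i| `^ r)%E.
  have [N [s [us _ hs]]] := H K; apply: esum_ge.
  by exists [set` s]; [split|rewrite -fsbig_seq].
move: e0 HK; case: (esum _ _) => [x||]// x0 HK.
have := HK (Num.bound (x / C)); rewrite lee_fin leNgt => /negP[].
by rewrite -ltr_pdivrMr//; apply: archi_boundP; rewrite divr_ge0// ltW.
Qed.

(** The growth rates [2^(n e)] that summability with exponent [p] tolerates. *)
Definition exponent_bound (R : realType) (p : \bar R) (e : R) : Prop :=
  (p <> +oo%E -> e < 0) /\ (p = +oo%E -> e <= 0).

Lemma powR2_ge1 (R : realType) (e : R) (n : nat) : 0 <= e -> 1 <= 2 `^ (n%:R * e).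
Proof.
move=> e0; rewrite -[leLHS](powRr0 2); apply: ler_powR; first by rewrite ler1n.
by rewrite mulr_ge0.
Qed.

Lemma powR2_unbounded (R : realType) (e M : R) : 0 < e ->
  exists N, forall n, (N <= n)%N -> M < 2 `^ (n%:R * e).
Proof.
move=> e0; exists (Num.bound (`|M| / (e * ln 2))) => n Nn.
have l2 : 0 < ln 2 :> R by rewrite ln_gt0// ltr1n.
have h : `|M| / (e * ln 2) < n%:R.
  apply: lt_le_trans (_ : (Num.bound (`|M| / (e * ln 2)))%:R <= _); last by rewrite ler_nat.
  by apply: archi_boundP; rewrite divr_ge0// mulr_ge0// ltW.
rewrite ltr_pdivrMr ?mulr_gt0// mulrA in h.
rewrite /powR ifF; last by rewrite pnatr_eq0.
apply: le_lt_trans (ler_norm M) _; apply: lt_trans h _.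
apply: lt_le_trans (expR_ge1Dx _); lra.
Qed.

(** A block with [2^(n e2)] entries of size [2^(n e1)] has quasi-norm of order
    [2^(n (e1 + e2 / p))].  For finite [p] already bounded blocks, [e = 0],
    force divergence when there are infinitely many of them; for a supremum
    only unbounded ones do.  This is the source of the difference between
    strict and weak inequalities in the necessary conditions. *)
Lemma lp_norm_exponent_bound (R : realType) (I : choiceType) (p : \bar R)
    (C1 C2 e1 e2 : R) (u : I -> \bar R) (W : nat -> seq I) :
  (0 < p)%E -> 0 < C1 -> 0 < C2 ->
  (forall n, uniq (W n)) ->
  (forall m n i, i \in W m -> i \in W n -> m = n) ->
  (forall N, exists2 n, (N <= n)%N & C2 * 2 `^ (n%:R * e2) <=
     (count (fun i => (C1 * 2 `^ (n%:R * e1))%:E <= `|u i|)%E (W n))%:R) ->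
  (lp_norm p u < +oo)%E ->
  exponent_bound p (e1 + Defs.divp e2 p).
Proof.
move=> p0 C10 C20 uW dW io fin; split => hp; (rewrite ltNge || rewrite leNgt); apply/negP => e0.
- case: p p0 fin hp e0 => [r||]// r0 fin _; rewrite /Defs.divp => e0; move: fin.
  rewrite lte_fin in r0.
  rewrite (@lp_norm_recurrent_blocks R I r (C1 `^ r * C2) u W)// ?mulr_gt0 ?powR_gt0//.
  move=> N; have [n Nn hn] := io N; exists n => //.
  apply: le_trans (@sum_poweR_ge_count R I r (C1 * 2 `^ (n%:R * e1)) u (W n) r0 _); last first.
    by rewrite mulr_ge0 ?powR_ge0 ?ltW.
  rewrite lee_fin; apply: le_trans (_ : (C1 * 2 `^ (n%:R * e1)) `^ r *
    (C2 * 2 `^ (n%:R * e2)) <= _); last first.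
    by rewrite ler_wpM2l// powR_ge0.
  rewrite powRM ?powR_ge0 ?(ltW C10)// -powRrM mulrACA.
  rewrite ler_peMr ?mulr_ge0 ?powR_ge0 ?(ltW C20)//.
  rewrite -powRD; last by rewrite pnatr_eq0 implybT.
  rewrite -mulrA -mulrDr; apply: powR2_ge1.
  have -> : e1 * r + e2 = (e1 + e2 / r) * r by rewrite mulrDl divfK// gt_eqF.
  by rewrite mulr_ge0 // ltW.
- move: e0; rewrite hp /Defs.divp addr0 => e0.
  have Mlt : forall M : R, (M%:E < lp_norm p u)%E.
    move=> M; have [N hN] := @powR2_unbounded R e1 (M / C1) e0.
    have [n Nn hn] := io N.
    have : has (fun i => ((C1 * 2 `^ (n%:R * e1))%:E <= `|u i|)%E) (W n).
      by rewrite has_count -(ltr_nat R); apply: lt_le_trans hn; rewrite mulr_gt0// powR_gt0.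
    move=> /hasP[i _ hi]; apply: lt_le_trans (@lp_norm_ge_coord R I p u i p0).
    by apply: lt_le_trans hi; rewrite lte_fin mulrC -ltr_pdivrMr// hN.
  move: (Mlt (fine (lp_norm p u))) fin (Mlt 0).
  by case: (lp_norm p u) => [x||]//=; rewrite lte_fin ltxx.
Qed.

(** * A recurrence principle for pairwise independent events *)

(** With [x = S - E / 2] this is [2 t x - (t x)^2 <= 1_{x >= 0}], rearranged so
    that only nonnegative coefficients occur when [0 <= E]. *)
Lemma quadratic_le_indicator (R : realType) (t E S : R) : 0 <= t ->
  (2 * t + t ^+ 2 * E) * S <=
    (E / 2 <= S)%R%:R + (t * E + t ^+ 2 * (E ^+ 2 / 4) + t ^+ 2 * S ^+ 2).
Proof.
move=> t0; have [h|h] := leP (E / 2) S.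
  have := sqr_ge0 (1 - t * (S - E / 2)); rewrite mulr1n; lra.
have h0 : 0 <= E / 2 - S by lra.
have := mulr_ge0 t0 h0; have := sqr_ge0 (t * (S - E / 2)); rewrite mulr0n; lra.
Qed.

Lemma count_indic (R : realType) (Omega K : Type) (B : K -> set Omega)
    (V : seq K) (w : Omega) :
  (count (fun k => w \in B k) V)%:R = \sum_(k <- V) \1_(B k) w :> R.
Proof.
rewrite -sum1_count natr_sum big_mkcond/=; apply: eq_bigr => k _.
by rewrite indicE; case: (w \in B k).
Qed.

Section probability.
Context {R : realType} {disp : measure_display} {Omega : measurableType disp}.
Variable P : probability Omega R.

(** A pointwise inequality between nonnegative combinations of indicators can
    be integrated; the form is chosen so that no integral remains. *)
Lemma le_sum_probability (I J : Type) (s : seq I) (t : seq J)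
    (c : I -> R) (A : I -> set Omega) (e : J -> R) (B : J -> set Omega) :
  (forall i, 0 <= c i) -> (forall i, measurable (A i)) ->
  (forall j, 0 <= e j) -> (forall j, measurable (B j)) ->
  (forall w, \sum_(i <- s) c i * \1_(A i) w <= \sum_(j <- t) e j * \1_(B j) w) ->
  \sum_(i <- s) c i * fine (P (A i)) <= \sum_(j <- t) e j * fine (P (B j)).
Proof.
move=> c0 mA e0 mB AB.
have int (L : Type) (r : seq L) (g : L -> R) (D : L -> set Omega) :
    (forall l, 0 <= g l) -> (forall l, measurable (D l)) ->
    (\int[P]_w (\sum_(l <- r) g l * \1_(D l) w)%:E)%E
      = (\sum_(l <- r) g l * fine (P (D l)))%:E.
  move=> g0 mD; under eq_integral do rewrite -sumEFin.
  rewrite ge0_integral_sum//.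
  - rewrite -sumEFin; apply: eq_bigr => l _.
    under eq_integral do rewrite EFinM.
    rewrite ge0_integralZl_EFin//.
    + by rewrite integral_indic// setIT EFinM fineK// fin_num_measure.
    + by apply/measurable_EFinP; exact: measurable_indic.
  - move=> l; apply/measurable_EFinP/measurable_funM => //; exact: measurable_indic.
  - by move=> l w _; rewrite lee_fin mulr_ge0.
rewrite -lee_fin -!int//; apply: ge0_le_integral => //.
- by move=> w _; rewrite lee_fin sumr_ge0// => i _; rewrite mulr_ge0.
- apply/measurable_EFinP/measurable_sum => i.
  by apply: measurable_funM => //; exact: measurable_indic.
- apply/measurable_EFinP/measurable_sum => i.
  by apply: measurable_funM => //; exact: measurable_indic.
- by move=> w _; rewrite lee_fin.
Qed.

Lemma measurable_count_ge (K : Type) (B : K -> set Omega) (V : seq K) (y : R) :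
  (forall k, measurable (B k)) ->
  measurable [set w | y <= (count (fun k => w \in B k) V)%:R].
Proof.
move=> mB.
have -> : [set w | y <= (count (fun k => w \in B k) V)%:R] =
    setT `&` (fun w => \sum_(k <- V) \1_(B k) w) @^-1` `[y, +oo[.
  by apply/seteqP; split=> w /=; rewrite in_itv/= andbT count_indic// => -[].
have mS : measurable_fun setT (fun w => \sum_(k <- V) \1_(B k) w : R).
  by apply: measurable_sum => k; exact: measurable_indic.
by apply: mS => //; exact: measurable_itv.
Qed.

(** Integrating [quadratic_le_indicator] for the count [S] only involves the
    first two moments of [S], which pairwise independence bounds by [E] and
    [E + E^2]; the choice [t = 2 / (4 + E)] is optimal. *)
Lemma paley_zygmund_count (K : eqType) (B : K -> set Omega) (V : seq K) :
  (forall k, measurable (B k)) ->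
  (forall k l, k != l -> P (B k `&` B l) = P (B k) * P (B l))%E ->
  uniq V ->
  let E := \sum_(k <- V) fine (P (B k)) in
  0 < E ->
  E / (4 + E) <=
    fine (P [set w | E / 2 <= (count (fun k => w \in B k) V)%:R]).
Proof.
move=> mB pw uV E E0; set A := [set w | _].
have mA : measurable A by exact: measurable_count_ge.
have p0 k : 0 <= fine (P (B k)) by rewrite fine_ge0.
have second_moment :
    \sum_(k <- V) \sum_(l <- V) fine (P (B k `&` B l)) <= E + E ^+ 2.
  rewrite expr2 {2}/E mulr_suml -big_split/=.
  rewrite big_seq [leRHS]big_seq; apply: ler_sum => k kV.
  rewrite mulr_sumr (bigD1_seq k)//= [in leRHS](bigD1_seq k)//= setIid lerD2l.
  rewrite -[leLHS]add0r lerD ?mulr_ge0//; apply: ler_sum => l lk.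
  by rewrite pw 1?eq_sym// fineM ?fin_num_measure.
pose t := 2 / (4 + E).
have t0 : 0 <= t by rewrite divr_ge0 ?addr_ge0// ltW.
(* The right-hand side of the quadratic bound is indexed by None for the event
   A, Some None for the constant, and Some (Some (k, l)) for the pairs in the
   expansion of S ^ 2. *)
pose e (j : option (option (K * K))) : R :=
  match j with None => 1 | Some None => t * E + t ^+ 2 * (E ^+ 2 / 4)
  | Some (Some _) => t ^+ 2 end.
pose D (j : option (option (K * K))) : set Omega :=
  match j with None => A | Some None => setT
  | Some (Some kl) => B kl.1 `&` B kl.2 end.
have := @le_sum_probability K _ V
  [:: None, Some None & [seq Some (Some (k, l)) | k <- V, l <- V]]
  (fun=> 2 * t + t ^+ 2 * E) B e D.
rewrite !big_cons !big_allpairs_dep/= -!mulr_sumr -/E probability_setT/=.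
under [X in _ -> _ <= _ + (_ + X)]eq_bigr do rewrite -mulr_sumr.
rewrite -mulr_sumr mul1r mulr1 => H.
suff bound : (2 * t + t ^+ 2 * E) * E <=
    fine (P A) + (t * E + t ^+ 2 * (E ^+ 2 / 4) + t ^+ 2 * (E + E ^+ 2)).
  have E4 : 4 + E != 0 by rewrite gt_eqF// addr_gt0.
  have -> : E / (4 + E) = t * E - t ^+ 2 * (E ^+ 2 / 4 + E) by rewrite /t; field.
  by move: bound; clear H; move: (fine (P A)) => a; lra.
apply: le_trans (H _ _ _ _ _) _ => {H}.
- by move=> _; apply: addr_ge0; apply: mulr_ge0; rewrite ?exprn_ge0 ?(ltW E0).
- exact: mB.
- case=> [[_|]|]//=; first by rewrite exprn_ge0.
  by apply: addr_ge0; apply: mulr_ge0; rewrite // ?divr_ge0 ?exprn_ge0 ?(ltW E0).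
- by case=> [[kl|]|]//=; exact: measurableI.
- move=> w; rewrite !big_cons !big_allpairs_dep/= -!mulr_sumr -count_indic.
  set S := (count _ V)%:R.
  have SE : S = \sum_(k <- V) \1_(B k) w by exact: count_indic.
  have -> : \sum_(k <- V) \sum_(l <- V) t ^+ 2 * \1_(B k `&` B l) w = t ^+ 2 * S ^+ 2.
    under eq_bigr do rewrite -mulr_sumr.
    rewrite -mulr_sumr [S ^+ 2]expr2 {1}SE mulr_suml; congr (_ * _).
    apply: eq_bigr => k _; rewrite SE mulr_sumr.
    by apply: eq_bigr => l _; rewrite indicI.
  rewrite indicT mulr1 mul1r.
  rewrite indicE mem_setE; exact: quadratic_le_indicator.
- by rewrite !lerD2l ler_wpM2l// exprn_ge0.
Qed.

(** The limit superior of events whose probabilities are bounded below has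
    positive probability, so it meets every almost sure event. *)
Lemma ae_exists_recurrent (K : eqType) (B : K -> set Omega) (V : nat -> seq K)
    (y : nat -> R) (y0 : R) (Q : Omega -> Prop) :
  (forall k, measurable (B k)) ->
  (forall k l, k != l -> P (B k `&` B l) = P (B k) * P (B l))%E ->
  (forall n, uniq (V n)) ->
  0 < y0 -> (forall n, y0 <= y n) ->
  (forall n, y n <= \sum_(k <- V n) fine (P (B k))) ->
  {ae P, forall w, Q w} ->
  exists w, Q w /\ forall N, exists2 n, (N <= n)%N &
    y n / 2 <= (count (fun k => w \in B k) (V n))%:R.
Proof.
move=> mB pw uV y00 y0y yE [N [mN N0 QN]].
pose F n := [set w | y n / 2 <= (count (fun k => w \in B k) (V n))%:R].
have mF n : measurable (F n) by exact: measurable_count_ge.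
have PF n : ((y0 / (4 + y0))%:E <= P (F n))%E.
  have yn0 : 0 < y n by exact: lt_le_trans (y0y n).
  have En0 := lt_le_trans yn0 (yE n).
  have := paley_zygmund_count mB pw (uV n) En0.
  set E := \sum_(k <- V n) _ in En0 * => h.
  apply: (@le_trans _ _ (P [set w | E / 2 <= (count (fun k => w \in B k) (V n))%:R])).
    rewrite -[leRHS]fineK ?fin_num_measure ?lee_fin//; last exact: measurable_count_ge.
    apply: le_trans h.
    rewrite ler_pdivrMr ?addr_gt0// mulrAC ler_pdivlMr ?addr_gt0//.
    have := le_trans (y0y n) (yE n); rewrite -/E; nra.
  rewrite le_measure ?inE//; first exact: measurable_count_ge.
  by move=> w; apply: le_trans; rewrite ler_pM2r// yE.
have PL : ((y0 / (4 + y0))%:E <= P (lim_sup_set F))%E.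
  have cv := @lim_sup_set_cvg _ _ _ P F mF.
  have {}cv := cv (le_lt_trans (probability_le1 P (bigcup_measurable (fun k _ => mF k))) (ltry 1)).
  rewrite -(cvg_lim _ cv)//; apply: lime_ge; first by apply/cvg_ex; eexists; exact: cv.
  apply: nearW => n; apply: le_trans (PF n) _; rewrite le_measure ?inE//.
    by apply: bigcup_measurable => k _; exact: mF.
  by move=> w Fw; exists n => //=.
have : ~ (lim_sup_set F `<=` N).
  move=> LN; have : (P (lim_sup_set F) <= P N)%E.
    rewrite le_measure ?inE//; apply: bigcapT_measurable => n.
    by apply: bigcup_measurable => k _; exact: mF.
  rewrite N0 => /(le_trans PL); rewrite lee_fin leNgt => /negP; apply.
  by rewrite divr_gt0// addr_gt0.
move=> /existsNP[w /not_implyP[Lw Nw]]; exists w; split.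
  by apply: contrapT => nQ; apply: Nw; exact: QN.
by move=> n; have [k nk Fk] := Lw n I; exists k.
Qed.

End probability.

(** * Active coefficients *)

Lemma exists_threshold (R : realType) (disp : measure_display)
    (Omega : measurableType disp) (P : probability Omega R) (X : {RV P >-> R}) :
  (0 < P [set w | X w != 0%R])%E ->
  exists2 c : R, 0 < c & (0 < P [set w | (c <= `|X w|)%R])%E.
Proof.
move=> X0; apply: contrapT => nc.
have mX c : measurable [set w | c <= `|X w|].
  have -> : [set w | c <= `|X w|] = setT `&` (Num.norm \o X : Omega -> R) @^-1` `[c, +oo[.
    by apply/seteqP; split=> w /=; rewrite in_itv/= andbT// => -[].
  have mN : measurable_fun setT (Num.norm \o X : Omega -> R) by apply: measurableT_comp.
  by apply: mN => //; exact: measurable_itv.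
have N : P.-negligible (\bigcup_n [set w | n.+1%:R^-1 <= `|X w|]).
  apply: negligible_bigcup => n; apply/negligibleP => //.
  apply: contrapT => /eqP; rewrite -measure_gt0 => h; apply: nc.
  by exists n.+1%:R^-1 => //; rewrite invr_gt0.
have : P.-negligible [set w | X w != 0].
  apply: negligibleS N => w /= Xw.
  exists (Num.bound (`|X w|^-1)) => //=.
  rewrite -[leRHS]invrK lef_pV2 ?posrE ?invr_gt0 ?normr_gt0//.
  apply/ltW; apply: lt_trans (archi_boundP _) _; rewrite ?invr_ge0 ?normr_ge0//.
  by rewrite ltr_nat.
move=> /measure_negligible H; move: X0; rewrite H ?ltxx//.
have -> : [set w | X w != 0] = setT `&` X @^-1` (~` [set 0]).
  apply/seteqP; split=> w /=; first by move=> /eqP.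
  by move=> [_ /eqP].
by apply: measurable_funPT => //; exact: measurableC.
Qed.

Section active.
Context {R : realType} {disp : measure_display} {Omega : measurableType disp}.
Variable P : probability Omega R.
Context {d : nat}.
Variables (xi : full_index d -> {RV P >-> R}) (lam : full_index d -> {RV P >-> bool}).
Variables (c : R).

Definition active (k : full_index d) : set Omega :=
  [set w | lam k w /\ c <= `|xi k w|].

Let large : set R := [set x | c <= `|x|].

Lemma measurable_large : measurable large.
Proof.
have -> : large = setT `&` (@Num.norm R R) @^-1` `[c, +oo[.
  by apply/seteqP; split=> w /=; rewrite /large/= in_itv/= andbT// => -[].
have mN : measurable_fun [set: R] (@Num.norm R R) by exact: normr_measurable.
by apply: mN => //; exact: measurable_itv.
Qed.

(** Activity is the intersection of one event for each of the two variables
    attached to [k], and these events form an independent family. *)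
Let part (k : full_index d + full_index d) : set Omega :=
  match k with inl k => xi k @^-1` large | inr k => lam k @^-1` [set true] end.

Let active_part k : active k = part (inl k) `&` part (inr k).
Proof. by apply/seteqP; split=> w /= []. Qed.

Lemma measurable_active k : measurable (active k).
Proof.
rewrite active_part; apply: measurableI.
  by rewrite -[X in measurable X]setTI; apply: measurable_funPT => //; exact: measurable_large.
by rewrite -[X in measurable X]setTI; apply: measurable_funPT.
Qed.

Variables (X : {RV P >-> R}) (mu nu : R).
Hypothesis xiX : forall k, same_distribution (xi k) X.
Hypothesis lamB : forall k, is_bernoulli (activation mu nu k.1.1 k.2) (lam k).
Hypothesis indep : mutually_independent P
          (fun k : full_index d + full_index d =>
             match k with
             | inl k => events_of (xi k)
             | inr k => events_of (lam k)
             end).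

Let indep_parts (s : seq (full_index d + full_index d)) : uniq s ->
  P (\big[setI/setT]_(i <- s) part i) = (\prod_(i <- s) P (part i))%E.
Proof.
move=> us; apply: indep => // -[k|k] _ /=.
  by exists large; [exact: measurable_large|rewrite setTI].
by exists [set true] => //; rewrite setTI.
Qed.

Lemma probability_active k : 0 <= activation mu nu k.1.1 k.2 <= 1 ->
  P (active k) = (P [set w | (c <= `|X w|)%R] * (activation mu nu k.1.1 k.2)%:E)%E.
Proof.
move=> a01; have := @indep_parts [:: inl k; inr k] isT.
rewrite !big_cons !big_nil setIT mule1 -active_part => ->; congr (_ * _)%E.
  exact: (xiX k measurable_large).
rewrite -[LHS]/(distribution P (lam k) [set true]) lamB bernoulli_probE//.
by rewrite !diracE mem_set// memNset//= mule1 mule0 adde0.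
Qed.

Lemma active_pairwise_independent k l : k != l ->
  (P (active k `&` active l) = P (active k) * P (active l))%E.
Proof.
move=> kl; have := @indep_parts [:: inl k; inr k] isT.
have := @indep_parts [:: inl l; inr l] isT.
have uq : uniq [:: inl k; inr k; inl l; inr l : full_index d + full_index d].
  by rewrite /= !inE !(inj_eq inl_inj, inj_eq inr_inj) /= !orbF (negbTE kl).
have := indep_parts uq.
rewrite !big_cons !big_nil !setIT !mule1 setIA -!active_part => -> -> ->.
by rewrite muleA.
Qed.

End active.

(** * Dyadic boxes of the lattice *)

(** The lattice points with [2^n <= m_i < 2^(n+1)] for every [i]: they have the
    same cardinality, up to constants, as the dyadic annulus of radius [2^n],
    and are disjoint for different [n]. *)
Definition box (d n : nat) : seq (Zlattice d) :=
  [seq [ffun i => Posz (2 ^ n + f i)] | f : {ffun 'I_d -> 'I_(2 ^ n)}].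

Lemma box_uniq d n : uniq (box d n).
Proof.
rewrite map_inj_uniq ?enum_uniq// => f g /ffunP fg; apply/ffunP => i.
by have := fg i; rewrite !ffunE => -[/addnI /ord_inj].
Qed.

Lemma size_box d n : size (box d n) = (2 ^ (n * d))%N.
Proof. by rewrite size_map -cardE card_ffun !card_ord expnM. Qed.

Lemma sup_normZ_box d n (m : Zlattice d) : (0 < d)%N -> m \in box d n ->
  (2 ^ n <= sup_normZ m < 2 ^ n.+1)%N.
Proof.
move=> d0 /mapP[f _ ->]; rewrite /sup_normZ; apply/andP; split.
  apply: leq_trans (@leq_bigmax_cond _ xpredT _ (Ordinal d0) isT).
  by rewrite ffunE/= leq_addr.
apply: (big_ind (fun x => x < 2 ^ n.+1)%N); first by rewrite expn_gt0.
  by move=> x y hx hy; rewrite gtn_max hx hy.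
by move=> i _; rewrite ffunE/= expnS mul2n -addnn ltn_add2l.
Qed.

Lemma box_disjoint d m n (x : Zlattice d) : (0 < d)%N ->
  x \in box d m -> x \in box d n -> m = n.
Proof.
move=> d0 /(sup_normZ_box d0)/andP[m1 m2] /(sup_normZ_box d0)/andP[n1 n2].
apply/eqP; rewrite eqn_leq -(ltnS m) -(ltnS n).
by rewrite -(@ltn_exp2l 2 m) // -(@ltn_exp2l 2 n)// (leq_ltn_trans m1)// (leq_ltn_trans n1).
Qed.

Lemma powR2_nat (R : realType) (n : nat) : (2 : R) `^ n%:R = 2 ^+ n.
Proof. by rewrite powR_mulrn. Qed.

Lemma powR2_add (R : realType) (x y : R) : (2 : R) `^ (x + y) = 2 `^ x * 2 `^ y.
Proof. by rewrite powRD// pnatr_eq0 implybT. Qed.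

Lemma decay_box (R : realType) d l j (m : Zlattice d) : (0 < d)%N ->
  m \in box d (l + j) ->
  2 ^+ l <= (decay j m : R) <= 3 * 2 ^+ l.
Proof.
move=> d0 /(sup_normZ_box d0)/andP[m1 m2]; rewrite /decay.
have j0 : 0 < (2 : R) ^+ j by rewrite exprn_gt0.
have a1 : (2 : R) ^+ l <= (sup_normZ m)%:R / 2 ^+ j.
  by rewrite ler_pdivlMr// -exprD -natrX ler_nat.
have a2 : (sup_normZ m)%:R / 2 ^+ j <= 2 * (2 : R) ^+ l.
  by rewrite ler_pdivrMr// -mulrA -exprD -exprS -natrX ler_nat ltnW.
have l1 : 1 <= (2 : R) ^+ l by rewrite exprn_ege1// ler1n.
by apply/andP; split; lra.
Qed.

Lemma decay_ge1 (R : realType) d j (m : Zlattice d) : 1 <= decay j m :> R.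
Proof. by rewrite /decay lerDl divr_ge0// exprn_ge0. Qed.

(** The ratio of the decay factor to [2^l] lies between 1 and 3, so its power
    [theta], of either sign, costs at most a factor [3^|theta|]; the bound [b]
    allows one constant for several exponents. *)
Lemma decay_powR_box (R : realType) d l j (m : Zlattice d) (theta b : R) :
  (0 < d)%N -> m \in box d (l + j) -> `|theta| <= b ->
  3 `^ (- b) * 2 `^ (l%:R * theta) <= (decay j m : R) `^ theta.
Proof.
move=> d0 mB tb; have /andP[lo hi] := @decay_box R d l j m d0 mB.
have l0 : 0 < (2 : R) ^+ l by rewrite exprn_gt0.
set t : R := decay j m / 2 ^+ l.
have -> : decay j m = t * 2 ^+ l :> R by rewrite /t divfK// gt_eqF.
have t1 : 1 <= t by rewrite /t ler_pdivlMr// mul1r.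
have t3 : t <= 3 by rewrite /t ler_pdivrMr.
have t0 : 0 < t by exact: lt_le_trans t1.
rewrite powRM ?(ltW t0) ?(ltW l0)// powRrM powR2_nat.
rewrite ler_wpM2r ?powR_ge0//.
apply: (@le_trans _ _ (t `^ (- b))).
  rewrite !powRN lef_pV2 ?posrE ?powR_gt0//; apply: ler_powRl => //.
    exact: le_trans tb.
  exact: ltW.
by apply: ler_powR => //; rewrite lerNl (le_trans _ tb)// -normrN ler_norm.
Qed.

Lemma activation_itv (R : realType) d (mu nu : R) j (m : Zlattice d) :
  mu <= 0 -> nu <= 0 -> 0 <= activation mu nu j m <= 1.
Proof.
move=> mu0 nu0; rewrite /activation mulr_ge0 ?powR_ge0//=.
rewrite mulr_ile1 ?powR_ge0//.
  rewrite -[leRHS](powRr0 2); apply: ler_powR; rewrite ?ler1n//.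
  by rewrite mulr_ge0_le0.
rewrite -[leRHS](powRr0 (decay j m : R)); apply: ler_powR => //.
exact: decay_ge1.
Qed.

(** One admissible symbol per level is enough for the lower bounds; the
    constant word is admissible at every level when [0 < d]. *)
Definition pure_symbols (d j : nat) : symbols d :=
  [ffun=> if j == 0%N then symF else symM].

Lemma pure_symbols_in d j : (0 < d)%N -> pure_symbols d j \in Tset d j.
Proof.
move=> d0; rewrite /Tset /pure_symbols; case: eqP => _; rewrite !inE//.
apply/eqP => /ffunP/(_ (Ordinal d0)); by rewrite !ffunE.
Qed.

Definition level (d : nat) (d0 : (0 < d)%N) (j : nat) : scale_index d :=
  Sub (j, pure_symbols d j) (pure_symbols_in j d0).

Lemma level_inj d (d0 : (0 < d)%N) : injective (level d0).
Proof. by move=> i j /(congr1 val) /= []. Qed.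

(** The expected number of active points of a box: its cardinality times the
    order of magnitude of the activation probability in it. *)
Lemma powR2_box (R : realType) (j l d : nat) (mu nu : R) :
  (2 : R) `^ (j%:R * (d%:R + mu)) * 2 `^ (l%:R * (d%:R + nu)) =
  2 `^ (j%:R * mu) * 2 `^ (l%:R * nu) * 2 ^+ ((l + j) * d).
Proof.
rewrite -powR2_nat -!powR2_add natrM natrD; congr (_ `^ _); ring.
Qed.

(** * Necessary conditions *)

Lemma leq_count_in (T : eqType) (a1 a2 : pred T) (r : seq T) :
  {in r, forall x, a1 x -> a2 x} -> (count a1 r <= count a2 r)%N.
Proof.
move=> a12; rewrite (@eq_in_count _ a1 (predI (mem r) a1)).
  by apply: sub_count => x /andP[/a12].
by move=> x xr; rewrite /= xr.
Qed.

Lemma besov_norm_slice (R : realType) d (s : R) (p q : \bar R)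
    (a : J_index d -> R) (jt : scale_index d) :
  (0 < q)%E -> (besov_norm s p q a < +oo)%E ->
  (lp_norm p (fun m => (a (jt, m))%:E) < +oo)%E.
Proof.
move=> q0 fin; set L := lp_norm p _.
have := lp_norm_ge_coord (fun jt : scale_index d =>
    ((2 `^ ((val jt).1%:R * (s + d%:R / 2 - Defs.divp d%:R p)))%:E *
     lp_norm p (fun m : Zlattice d => (a (jt, m))%:E))%E) jt q0.
move=> /le_lt_trans/(_ fin); rewrite -/L ltNge; apply: contraNT.
rewrite -leNgt leye_eq => /eqP ->.
by rewrite gt0_muley// lte_fin powR_gt0.
Qed.

Section prior_necessity.
Context {R : realType} {disp : measure_display} {Omega : measurableType disp}.
Variable P : probability Omega R.
Variables (d : nat) (s alpha beta gamma : R) (p q : \bar R) (mu nu : R).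
Variables (X : {RV P >-> R}) (a : J_index d -> {RV P >-> R}).
Hypotheses (d0 : (0 < d)%N) (p0 : (0 < p)%E) (q0 : (0 < q)%E).
Hypotheses (mu_itv : - d%:R <= mu <= 0) (nu_itv : - d%:R <= nu <= 0).
Hypothesis prior : besov_bernoulli_prior alpha beta gamma mu nu X a.
Hypothesis X0 : (0 < P [set w | X w != 0%R])%E.

(** The exponent of the decay factor in [amplitude]. *)
Definition level_exponent (j : nat) : R := beta + (gamma - beta) * (j == 0%N)%:R.

(** The left-hand side is half a lower bound for the expected number of active
    coefficients, so this is [ae_exists_recurrent] for the boxes
    [box d (l n + j n)] at level [j n]; since [mu, nu >= -d], the expectations
    are bounded away from 0 for all sequences [j] and [l].  Both sequences are
    free because the conditions on gamma and beta come from [l n = n] at a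
    fixed level, and the condition on the smoothness from [j n = n], [l n = 0]. *)
Lemma recurrent_large_coefficients :
  exists C1 C2 : R, [/\ 0 < C1, 0 < C2 & forall (Q : Omega -> Prop) (j l : nat -> nat),
  {ae P, forall w, Q w} -> exists w, Q w /\ forall N, exists2 n, (N <= n)%N &
    C2 * 2 `^ ((j n)%:R * (d%:R + mu)) * 2 `^ ((l n)%:R * (d%:R + nu)) <=
    (count (fun m => C1 * 2 `^ ((j n)%:R * alpha) *
                     2 `^ ((l n)%:R * level_exponent (j n))
                     <= `|a (level d0 (j n), m) w|) (box d (l n + j n)))%:R].
Proof.
have [mud mu0] := andP mu_itv; have [nud nu0] := andP nu_itv.
have [c c0 cX] := exists_threshold X0.
have [xi [lam [xiX lamB indep aE]]] := prior.
pose delta : R := fine (P [set w | (c <= `|X w|)%R]).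
have mX : measurable [set w | c <= `|X w|].
  rewrite (_ : [set w | _] = setT `&` X @^-1` [set x | c <= `|x|]) ?setTI//.
  rewrite -[X in measurable X]setTI.
  by apply: measurable_funPT => //; exact: measurable_large.
have Xdelta : P [set w | (c <= `|X w|)%R] = delta%:E.
  by rewrite /delta fineK ?fin_num_measure.
have delta0 : 0 < delta by rewrite -lte_fin -Xdelta.
pose b := `|beta| + `|gamma - beta|.
(* b bounds the exponents of all levels at once, so that the constants do not
   depend on the sequence of levels. *)
have theta_b j : `|level_exponent j| <= b.
  apply: le_trans (ler_normD _ _) _; rewrite lerD2l normrM ler_piMr//.
  by case: (j == 0%N); rewrite ?normr1// normr0.
pose C : R := delta * 3 `^ (- `|nu|).
have C0 : 0 < C by rewrite mulr_gt0// powR_gt0.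
exists (c * 3 `^ (- b)), (C / 2); split.
- by rewrite mulr_gt0// powR_gt0.
- by rewrite divr_gt0.
move=> Q j l aeQ.
pose V n : seq (full_index d) :=
  [seq ((j n, pure_symbols d (j n)), m) | m <- box d (l n + j n)].
pose y n := C * 2 `^ ((j n)%:R * (d%:R + mu)) * 2 `^ ((l n)%:R * (d%:R + nu)).
have Cy n : C <= y n.
  rewrite /y -mulrA ler_peMr ?(ltW C0)// -[leLHS](mulr1 1) ler_pM//.
    by apply: powR2_ge1; rewrite addrC -lerBlDr sub0r.
  by apply: powR2_ge1; rewrite addrC -lerBlDr sub0r.
have yE n : y n <= \sum_(k <- V n) fine (P (active xi lam c k)).
  rewrite /V big_map.
  apply: (@le_trans _ _ (\sum_(m <- box d (l n + j n))
      C * (2 `^ ((j n)%:R * mu) * 2 `^ ((l n)%:R * nu)))).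
    rewrite big_const_seq count_predT size_box iter_addr addr0 -[leRHS]mulr_natr natrX.
    by rewrite /y -[leLHS]mulrA -[leRHS]mulrA powR2_box.
  rewrite big_seq [leRHS]big_seq; apply: ler_sum => m mB.
  rewrite (probability_active c xiX lamB indep) ?activation_itv//= Xdelta -EFinM/=.
  rewrite /C -mulrA ler_pM2l// /activation mulrCA ler_wpM2l ?powR_ge0//.
  exact: decay_powR_box.
have uV n : uniq (V n) by rewrite map_inj_uniq ?box_uniq// => x x' [].
have [w [Qw io]] := ae_exists_recurrent (measurable_active xi lam c)
  (active_pairwise_independent c indep) uV C0 Cy yE aeQ.
exists w; split=> // N; have [n Nn hn] := io N; exists n => //.
have -> : C / 2 * 2 `^ ((j n)%:R * (d%:R + mu)) * 2 `^ ((l n)%:R * (d%:R + nu))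
    = y n / 2 by rewrite /y; ring.
apply: (le_trans hn); rewrite ler_nat /V count_map.
apply: leq_count_in => m mB /=; rewrite inE => -[lamw xiw].
rewrite aE/= lamw mulr1 /amplitude !normrM ger0_norm ?powR_ge0//.
rewrite [X in _ <= _ * X * _]ger0_norm ?powR_ge0//.
rewrite (_ : c * _ * _ * _ = 2 `^ ((j n)%:R * alpha) * (3 `^ (- b) *
  2 `^ ((l n)%:R * level_exponent (j n))) * c); last by ring.
apply: ler_pM => //; rewrite ?mulr_ge0 ?powR_ge0 ?(ltW c0)//.
by rewrite ler_wpM2l ?powR_ge0//; exact: decay_powR_box.
Qed.

(** Within one level, the boxes tending to infinity are disjoint blocks of the
    inner norm. *)
Lemma fixed_level_necessary (j : nat) :
  {ae P, forall w, besov_space s p q (fun i => a i w)} ->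
  exponent_bound p (level_exponent j + Defs.divp (d%:R + nu) p).
Proof.
have [C1 [C2 [C10 C20 H]]] := recurrent_large_coefficients.
move=> /(H _ (fun=> j) id)[w [fin io]].
apply: (@lp_norm_exponent_bound R _ p (C1 * 2 `^ (j%:R * alpha))
  (C2 * 2 `^ (j%:R * (d%:R + mu))) _ _ (fun m => (a (level d0 j, m) w)%:E)
  (fun n => box d (n + j))) => //.
- by rewrite mulr_gt0// powR_gt0.
- by rewrite mulr_gt0// powR_gt0.
- by move=> n; exact: box_uniq.
- by move=> m n i im /(box_disjoint d0 im) /addIn.
- exact: (besov_norm_slice _ q0 fin).
Qed.

(** The box [l = 0] at level [n] has decay factor of order 1, so it yields a
    lower bound for the whole inner norm at level [n], which is one entry of
    the outer norm. *)
Lemma all_levels_necessary :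
  {ae P, forall w, besov_space s p q (fun i => a i w)} ->
  exponent_bound q (s + d%:R / 2 + alpha + Defs.divp mu p).
Proof.
have [C1 [C2 [C10 C20 H]]] := recurrent_large_coefficients.
move=> /(H _ id (fun=> 0%N))[w [fin io]].
(* Blocks of the outer norm are singletons, whence e2 = 0. *)
rewrite -[X in exponent_bound _ X]addr0 -[X in _ + X](mul0r (Defs.divp 1 q)) -divpE.
apply: (@lp_norm_exponent_bound R (scale_index d) q (C1 * C2 `^ Defs.divp 1 p) 1 _ _ _
  (fun n => [:: level d0 n]) q0 _ _ _ _ _ fin) => //.
- by rewrite mulr_gt0// powR_gt0.
- by move=> m n i; rewrite !inE => /eqP -> /eqP /level_inj.
move=> N; have [n Nn hn] := io N; exists n => //.
rewrite mulr0 powRr0 mulr1 /= addn0.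
move: hn; rewrite !mul0r !powRr0 !mulr1 => hn.
set L := lp_norm p _.
have hL : ((C1 * 2 `^ (n%:R * alpha) *
    (C2 * 2 `^ (n%:R * (d%:R + mu))) `^ Defs.divp 1 p)%:E <= L)%E.
  by apply: (@lp_norm_ge_count _ _ _ _ _ _ (box d (0 + n)));
    rewrite // ?box_uniq ?mulr_gt0 ?mulr_ge0 ?powR_gt0 ?powR_ge0// ltW.
(* The singleton block counts 1 precisely when its entry is large. *)
suff -> : ((C1 * C2 `^ Defs.divp 1 p *
     2 `^ (n%:R * (s + d%:R / 2 + alpha + Defs.divp mu p)))%:E <=
   `|(2 `^ (n%:R * (s + d%:R / 2 - Defs.divp d%:R p)))%:E * L|)%E by [].
rewrite abseM; apply: (@le_trans _ _
  ((2 `^ (n%:R * (s + d%:R / 2 - Defs.divp d%:R p)))%:E * L)%E); last first.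
  apply: lee_pmul; rewrite ?lee_fin ?powR_ge0 ?ler_norm ?lee_abs//.
  by apply: le_trans hL; rewrite lee_fin !mulr_ge0 ?powR_ge0// ltW.
apply: le_trans (lee_pmul _ _ (lexx _) hL); rewrite ?lee_fin ?powR_ge0//; last first.
  by rewrite !mulr_ge0 ?powR_ge0// ltW.
rewrite powRM ?powR_ge0 ?(ltW C20)// -powRrM.
have -> : n%:R * (s + d%:R / 2 + alpha + Defs.divp mu p) =
  n%:R * (s + d%:R / 2 - Defs.divp d%:R p) + n%:R * alpha + n%:R * (d%:R + mu) * Defs.divp 1 p.
  by rewrite (divpE mu) (divpE d%:R); ring.
rewrite !powR2_add; set x := 2 `^ _; set y := 2 `^ _; set z := 2 `^ _.
by rewrite le_eqVlt; apply/orP; left; apply/eqP; ring.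
Qed.

End prior_necessity.

Theorem theorem4p3 (R : realType)
  (disp : measure_display) (Omega : measurableType disp)
  (P : probability Omega R)
  (d : nat) (s alpha beta gamma : R) (p q : \bar R) (mu nu : R)
  (X : {RV P >-> R}) (a : J_index d -> {RV P >-> R}) :
  (0 < d)%N -> (0 < p)%E -> (0 < q)%E ->
  - d%:R <= mu <= 0 -> - d%:R <= nu <= 0 ->
  besov_bernoulli_prior alpha beta gamma mu nu X a ->
  (0 < P [set w | X w != 0%R])%E ->
  {ae P, forall w : Omega, besov_space s p q (fun i => a i w)} ->
  property_A' d s p q alpha beta gamma mu nu.
Proof.
move=> d0 p0 q0 hmu hnu pr X0 fin.
(* Level 0 carries the exponent gamma, level 1 the exponent beta. *)
have := fixed_level_necessary d0 p0 q0 hmu hnu pr X0 0 fin.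
have := fixed_level_necessary d0 p0 q0 hmu hnu pr X0 1 fin.
have := all_levels_necessary d0 p0 q0 hmu hnu pr X0 fin.
rewrite /level_exponent eqxx /= mulr0 addr0 mulr1 addrCA subrr addr0.
case=> sq sqy [b1 b2] [g1 g2].
have [py|/eqP pny] := eqVneq p +oo%E; have [qy|/eqP qny] := eqVneq q +oo%E.
- move: (sqy qy) (b2 py) (g2 py); rewrite py /Defs.divp !addr0.
  by move=> ? ? ?; apply: Or44.
- move: (sq qny) (b2 py) (g2 py); rewrite py /Defs.divp !addr0.
  by move=> ? ? ?; apply: Or43.
- by apply: Or42; split=> //; [exact: g1|exact: b1|exact: sqy].
- by apply: Or41; split=> //; [exact: g1|exact: b1|exact: sq].
Qed.
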